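(* If $f$ is a Rogers function, $r>0$ and $\xi\in\mathbf{C}$ with $\operatorname{Re}\xi>0$, then $$\frac{1}{\sqrt2}\,\frac{|\xi|^2}{r^2+|\xi|^2}\left(\frac{\operatorname{Re}\xi}{|\xi|}\right)|f(r)|\le|f(\xi)|\le\sqrt2\,\frac{r^2+|\xi|^2}{r^2}\left(\frac{|\xi|}{\operatorname{Re}\xi}\right)|f(r)|.$$
   Context: A Rogers function is a holomorphic function $f$ on $\{\xi\in\mathbf{C}:\operatorname{Re}\xi>0\}$ with $\operatorname{Re}(f(\xi)/\xi)\ge0$ there. *)

(* Defs.v *)
From Stdlib Require Import Reals.
From Coquelicot Require Import Coquelicot.

Open Scope R_scope.

Definition right_half_plane (z : C) : Prop := 0 < Re z.

(* Complex differentiability at every point of D; as used below, D is open. *)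
Definition holomorphic_on (D : C -> Prop) (f : C -> C) : Prop :=
  forall z : C, D z -> @ex_derive C_AbsRing C_NormedModule f z.

(* A function on the right half-plane is represented by a total function on C
   whose values outside the half-plane are irrelevant. *)
Definition Rogers (f : C -> C) : Prop :=
  holomorphic_on right_half_plane f /\
  forall xi : C, right_half_plane xi -> 0 <= Re (f xi / xi)%C.

(* Main.v *)
(* The quotient g(z) = f(z)/z maps the right half-plane into the closed right
   half-plane, so by the Schwarz-Pick lemma |g'(z)| Re z <= Re g(z). Integrating
   along the hyperbolic geodesic from r to xi, with w = (xi - r)/(xi + r),
     |g(xi)| / |g(r)| <= (1 + |w|)/(1 - |w|) <= (r^2 + |xi|^2)/(r Re xi),
   and likewise for the reciprocal; this gives both bounds even without the factor
   sqrt 2. The Schwarz-Pick lemma reduces to |G'(0)| <= 2 Re G(0) for G on the unit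
   disc with nonnegative real part, which is the mean value property for G times a
   nonnegative kernel, and the latter follows from Goursat's theorem on rectangles
   in logarithmic coordinates. *)

Require Import Defs.
From Stdlib Require Import Reals Lra Psatz ClassicalEpsilon.
From Coquelicot Require Import Coquelicot.

Open Scope R_scope.

(** * Complex derivatives *)

(** The codomain is [C] as a module over itself, the structure for which the product rule is stated;
    [holomorphic_on] uses [C_NormedModule] instead. *)
Definition cderive (f : C -> C) (z l : C) : Prop :=
  @is_derive C_AbsRing (AbsRing_NormedModule C_AbsRing) f z l.

Lemma cderiveP (f : C -> C) (z l : C) :
  cderive f z l <->
  forall eps, 0 < eps -> exists delta, 0 < delta /\
    forall w, Cmod (w - z) < delta ->
      Cmod (f w - f z - (w - z) * l) <= eps * Cmod (w - z).
Proof.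
split.
- intros [_ H] eps Heps.
  destruct (H z (fun P HP => HP) (mkposreal eps Heps)) as [d Hd].
  exists d; split; [apply cond_pos|].
  intros w Hw; exact (Hd w Hw).
- intros H; split.
  + apply @is_linear_scal_l.
  + intros x Hx.
    apply (@is_filter_lim_locally_unique C_AbsRing (AbsRing_NormedModule C_AbsRing)) in Hx.
    subst x.
    intros eps.
    destruct (H eps (cond_pos eps)) as [d [Hd1 Hd2]].
    exists (mkposreal d Hd1); intros w Hw; exact (Hd2 w Hw).
Qed.

(** Both module structures on [C] have the norm [Cmod], so the little-o estimate is the same. *)
Lemma ex_derive_cderive (f : C -> C) (z : C) :
  @ex_derive C_AbsRing C_NormedModule f z -> exists l, cderive f z l.
Proof.
intros [l [_ H]]; exists l.
apply cderiveP; intros eps Heps.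
destruct (H z (fun P HP => HP) (mkposreal eps Heps)) as [d Hd].
exists d; split; [apply cond_pos|].
intros w Hw; exact (Hd w Hw).
Qed.

Lemma cderive_const (a z : C) : cderive (fun _ => a) z 0.
Proof. exact (@is_derive_const C_AbsRing (AbsRing_NormedModule C_AbsRing) a z). Qed.

Lemma cderive_id (z : C) : cderive (fun w => w) z 1.
Proof. exact (@is_derive_id C_AbsRing z). Qed.

Lemma cderive_plus (f g : C -> C) (z df dg : C) :
  cderive f z df -> cderive g z dg ->
  cderive (fun w => f w + g w)%C z (df + dg).
Proof. exact (@is_derive_plus C_AbsRing (AbsRing_NormedModule C_AbsRing) f g z df dg). Qed.

Lemma cderive_minus (f g : C -> C) (z df dg : C) :
  cderive f z df -> cderive g z dg ->
  cderive (fun w => f w - g w)%C z (df - dg).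
Proof. exact (@is_derive_minus C_AbsRing (AbsRing_NormedModule C_AbsRing) f g z df dg). Qed.

Lemma cderive_mult (f g : C -> C) (z df dg : C) :
  cderive f z df -> cderive g z dg ->
  cderive (fun w => f w * g w)%C z (df * g z + f z * dg).
Proof. intros Hf Hg; exact (@is_derive_mult C_AbsRing f g z df dg Hf Hg Cmult_comm). Qed.

Lemma cderive_comp (f g : C -> C) (z df dg : C) :
  cderive f (g z) df -> cderive g z dg ->
  cderive (fun w => f (g w)) z (dg * df).
Proof. exact (@is_derive_comp C_AbsRing (AbsRing_NormedModule C_AbsRing) f g z df dg). Qed.

Lemma cderive_inv (z : C) : z <> 0 -> cderive Cinv z (- / (z * z)).
Proof.
intros Hz; apply cderiveP; intros eps Heps.
assert (Hm : 0 < Cmod z) by now apply Cmod_gt_0.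
assert (Hm3 : 0 < Cmod z ^ 3) by now apply pow_lt.
(* The first bound keeps [Cmod w] above [Cmod z / 2], so that 1/(z z w) has modulus at most 2/|z|^3;
   the second absorbs that factor. *)
exists (Rmin (Cmod z / 2) (eps * Cmod z ^ 3 / 2)); split.
{ apply Rmin_pos; [lra|].
  apply Rdiv_lt_0_compat; [apply Rmult_lt_0_compat; lra|lra]. }
intros w Hw.
assert (H1 := Rlt_le_trans _ _ _ Hw (Rmin_l _ _)).
assert (H2 := Rlt_le_trans _ _ _ Hw (Rmin_r _ _)).
assert (Hwm : Cmod z / 2 < Cmod w).
{ assert (H := Cmod_triangle w (- (w - z))).
  rewrite Cmod_opp in H.
  replace (w + - (w - z))%C with z in H by ring. lra. }
assert (Hw0 : w <> 0) by (apply Cmod_gt_0; lra).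
replace (/ w - / z - (w - z) * - / (z * z))%C
  with ((w - z) * ((w - z) / (z * z * w)))%C by (field; auto).
rewrite Cmod_mult, Rmult_comm.
apply Rmult_le_compat_r; [apply Cmod_ge_0|].
rewrite Cmod_div by (repeat apply Cmult_neq_0; auto).
rewrite !Cmod_mult.
apply Rle_div_l; [nra|].
assert (eps * Cmod z ^ 3 / 2 <= eps * (Cmod z * Cmod z * Cmod w)); [|lra].
assert (0 < Cmod z * Cmod z) by nra.
assert (Cmod z ^ 3 / 2 <= Cmod z * Cmod z * Cmod w) by nra.
nra.
Qed.

Definition cdifferentiable (f : C -> C) (z : C) : Prop :=
  exists l, cderive f z l.

Lemma cdiff_const (a z : C) : cdifferentiable (fun _ => a) z.
Proof. eexists; apply cderive_const. Qed.

Lemma cdiff_id (z : C) : cdifferentiable (fun w => w) z.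
Proof. eexists; apply cderive_id. Qed.

Lemma cdiff_plus (f g : C -> C) (z : C) :
  cdifferentiable f z -> cdifferentiable g z ->
  cdifferentiable (fun w => f w + g w)%C z.
Proof. intros [a Ha] [b Hb]; eexists; apply cderive_plus; eassumption. Qed.

Lemma cdiff_minus (f g : C -> C) (z : C) :
  cdifferentiable f z -> cdifferentiable g z ->
  cdifferentiable (fun w => f w - g w)%C z.
Proof. intros [a Ha] [b Hb]; eexists; apply cderive_minus; eassumption. Qed.

Lemma cdiff_mult (f g : C -> C) (z : C) :
  cdifferentiable f z -> cdifferentiable g z ->
  cdifferentiable (fun w => f w * g w)%C z.
Proof. intros [a Ha] [b Hb]; eexists; apply cderive_mult; eassumption. Qed.

Lemma cdiff_comp (f g : C -> C) (z : C) :
  cdifferentiable f (g z) -> cdifferentiable g z ->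
  cdifferentiable (fun w => f (g w)) z.
Proof. intros [a Ha] [b Hb]; eexists; apply cderive_comp; eassumption. Qed.

Lemma cdiff_inv (z : C) : z <> 0 -> cdifferentiable Cinv z.
Proof. intros Hz; eexists; now apply cderive_inv. Qed.

Ltac cdiff :=
  lazymatch goal with
  | |- cdifferentiable (fun _ => ?a) _ => apply (cdiff_const a)
  | |- cdifferentiable (fun w => w) _ => apply cdiff_id
  | |- cdifferentiable (fun w => / w)%C _ => apply cdiff_inv; assumption
  | |- cdifferentiable (fun w => @?f w + @?g w)%C _ => apply (cdiff_plus f g); cdiff
  | |- cdifferentiable (fun w => @?f w - @?g w)%C _ => apply (cdiff_minus f g); cdiff
  | |- cdifferentiable (fun w => @?f w * @?g w)%C _ => apply (cdiff_mult f g); cdiff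
  | |- _ => assumption
  end.

Lemma re_minus (a b : C) : Re (a - b) = Re a - Re b.
Proof. reflexivity. Qed.

Lemma im_minus (a b : C) : Im (a - b) = Im a - Im b.
Proof. reflexivity. Qed.

Lemma im_le_Cmod (z : C) : Rabs (Im z) <= Cmod z.
Proof. eapply Rle_trans; [apply Rmax_r|apply Rmax_Cmod]. Qed.

Lemma Cmod_le_Rabs (z : C) : Cmod z <= Rabs (Re z) + Rabs (Im z).
Proof.
replace z with (RtoC (Re z) + Ci * RtoC (Im z))%C at 1
  by (apply injective_projections; simpl; unfold Re, Im; ring).
eapply Rle_trans; [apply Cmod_triangle|].
rewrite Cmod_mult, Cmod_Ci, !Cmod_R; lra.
Qed.

Lemma is_derive_eps (f : R -> R) (t l : R) :
  (forall eps, 0 < eps -> exists delta, 0 < delta /\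
    forall u, Rabs (u - t) < delta ->
      Rabs (f u - f t - (u - t) * l) <= eps * Rabs (u - t)) ->
  is_derive f t l.
Proof.
intros H; split.
- apply @is_linear_scal_l.
- intros x Hx.
  apply (@is_filter_lim_locally_unique R_AbsRing R_NormedModule) in Hx.
  subst x; intros eps.
  destruct (H eps (cond_pos eps)) as [d [Hd1 Hd2]].
  exists (mkposreal d Hd1); intros w Hw; exact (Hd2 w Hw).
Qed.

Lemma cderive_line (f : C -> C) (p v l : C) (t : R) :
  cderive f (p + RtoC t * v) l ->
  is_derive (fun u : R => Re (f (p + RtoC u * v)%C)) t (Re (v * l)%C) /\
  is_derive (fun u : R => Im (f (p + RtoC u * v)%C)) t (Im (v * l)%C).
Proof.
intros H.
assert (E : forall eps, 0 < eps -> exists delta, 0 < delta /\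
    forall u, Rabs (u - t) < delta ->
      Cmod (f (p + RtoC u * v) - f (p + RtoC t * v) - RtoC (u - t) * (v * l))%C
      <= eps * Rabs (u - t)).
{ intros eps Heps.
  assert (Hv := Cmod_ge_0 v).
  (* Dividing by [Cmod v + 1] instead of [Cmod v] covers the case [v = 0]. *)
  destruct (proj1 (cderiveP _ _ _) H (eps / (Cmod v + 1))) as [d [Hd1 Hd2]].
  { apply Rdiv_lt_0_compat; lra. }
  exists (d / (Cmod v + 1)); split; [apply Rdiv_lt_0_compat; lra|].
  intros u Hu.
  assert (Hx : (p + RtoC u * v - (p + RtoC t * v) = RtoC (u - t) * v)%C)
    by (rewrite RtoC_minus; ring).
  assert (Hu' : Rabs (u - t) * (Cmod v + 1) < d) by (apply Rlt_div_r; lra).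
  assert (Ha := Rabs_pos (u - t)).
  specialize (Hd2 (p + RtoC u * v)%C).
  rewrite Hx, Cmod_mult, Cmod_R in Hd2.
  rewrite Cmult_assoc.
  eapply Rle_trans; [apply Hd2; nra|].
  apply (Rmult_le_reg_r (Cmod v + 1)); [lra|].
  field_simplify; [|lra].
  assert (0 <= eps * Rabs (u - t)) by nra. nra. }
assert (ER : forall (k : R) (z : C), Re (RtoC k * z)%C = k * Re z)
  by (intros; unfold Re; simpl; ring).
assert (EI : forall (k : R) (z : C), Im (RtoC k * z)%C = k * Im z)
  by (intros; unfold Im; simpl; ring).
split; apply is_derive_eps; intros eps Heps;
  destruct (E eps Heps) as [d [Hd1 Hd2]]; exists d; (split; [exact Hd1|]);
  intros u Hu; (eapply Rle_trans; [|apply (Hd2 u Hu)]).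
- rewrite <- ER, <- !re_minus; apply re_le_Cmod.
- rewrite <- EI, <- !im_minus; apply im_le_Cmod.
Qed.

Lemma continuous_horizontal (f : C -> C) (x y : R) :
  cdifferentiable f (x, y) -> continuous (fun s : R => Im (f (s, y))) x.
Proof.
intros [l H].
assert (E : forall s : R, ((0, y) + RtoC s * 1)%C = (s, y))
  by (intros; apply injective_projections; simpl; ring).
rewrite <- E in H.
apply cderive_line in H; destruct H as [_ H].
apply (continuous_ext (fun s : R => Im (f ((0, y) + RtoC s * 1)%C))).
- intros s; now rewrite E.
- apply @ex_derive_continuous; eexists; exact H.
Qed.

Lemma continuous_vertical (f : C -> C) (x y : R) :
  cdifferentiable f (x, y) -> continuous (fun t : R => Re (f (x, t))) y.
Proof.
intros [l H].
assert (E : forall s : R, ((x, 0) + RtoC s * Ci)%C = (x, s))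
  by (intros; apply injective_projections; simpl; ring).
rewrite <- E in H.
apply cderive_line in H; destruct H as [H _].
apply (continuous_ext (fun s : R => Re (f ((x, 0) + RtoC s * Ci)%C))).
- intros s; now rewrite E.
- apply @ex_derive_continuous; eexists; exact H.
Qed.

(** * Goursat's theorem on rectangles *)

(** Since dz is ds on horizontal and i dt on vertical segments, the imaginary part of f dz is Im f
    ds and Re f dt respectively. The vertical integrals of Re f are what the mean value property
    needs. *)
Definition hint (f : C -> C) (y a b : R) : R := RInt (fun s => Im (f (s, y))) a b.
Definition vint (f : C -> C) (x c d : R) : R := RInt (fun t => Re (f (x, t))) c d.

(* The imaginary part of the integral of [f] along the boundary of the
   rectangle with lower left corner [(a, c)], width [h] and height [k]. *)
Definition boundary_int (f : C -> C) (a c h k : R) : R :=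
  hint f c a (a + h) - hint f (c + k) a (a + h)
  + vint f (a + h) c (c + k) - vint f a c (c + k).

Definition cdiff_on_rect (f : C -> C) (a c h k : R) : Prop :=
  forall x y, a <= x <= a + h -> c <= y <= c + k -> cdifferentiable f (x, y).

Lemma ex_hint (f : C -> C) (a c h k y a' b' : R) :
  cdiff_on_rect f a c h k -> c <= y <= c + k ->
  a <= a' <= b' -> b' <= a + h -> ex_RInt (fun s => Im (f (s, y))) a' b'.
Proof.
intros H Hy Ha Hb; apply (ex_RInt_continuous (V := R_CompleteNormedModule)); intros z.
rewrite Rmin_left, Rmax_right by lra; intros Hz.
apply (continuous_horizontal f z y), H; lra.
Qed.

Lemma ex_vint (f : C -> C) (a c h k x c' d' : R) :
  cdiff_on_rect f a c h k -> a <= x <= a + h ->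
  c <= c' <= d' -> d' <= c + k -> ex_RInt (fun t => Re (f (x, t))) c' d'.
Proof.
intros H Hx Hc Hd; apply (ex_RInt_continuous (V := R_CompleteNormedModule)); intros z.
rewrite Rmin_left, Rmax_right by lra; intros Hz.
apply (continuous_vertical f x z), H; lra.
Qed.

(** Each inner side belongs to two quarters with opposite orientations and cancels; the halves of
    the outer sides recombine by Chasles. *)
Lemma boundary_int_split (f : C -> C) (a c h k : R) :
  0 <= h -> 0 <= k -> cdiff_on_rect f a c h k ->
  boundary_int f a c h k =
    boundary_int f a c (h / 2) (k / 2)
    + boundary_int f (a + h / 2) c (h / 2) (k / 2)
    + boundary_int f a (c + k / 2) (h / 2) (k / 2)
    + boundary_int f (a + h / 2) (c + k / 2) (h / 2) (k / 2).
Proof.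
intros Hh Hk H; unfold boundary_int.
replace (a + h / 2 + h / 2) with (a + h) by field.
replace (c + k / 2 + k / 2) with (c + k) by field.
assert (HH : forall y, c <= y <= c + k ->
  hint f y a (a + h / 2) + hint f y (a + h / 2) (a + h) = hint f y a (a + h)).
{ intros y Hy; apply (RInt_Chasles (V := R_CompleteNormedModule)); eapply ex_hint; eauto; lra. }
assert (HV : forall x, a <= x <= a + h ->
  vint f x c (c + k / 2) + vint f x (c + k / 2) (c + k) = vint f x c (c + k)).
{ intros x Hx; apply (RInt_Chasles (V := R_CompleteNormedModule)); eapply ex_vint; eauto; lra. }
rewrite <- !HH, <- !HV by lra; ring.
Qed.

Lemma RInt_near_const (f g : R -> R) (a b K E : R) :
  a <= b -> ex_RInt f a b -> ex_RInt g a b ->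
  (forall x, a <= x <= b -> Rabs (f x - g x - K) <= E) ->
  Rabs (RInt f a b - RInt g a b - (b - a) * K) <= (b - a) * E.
Proof.
intros Hab Hf Hg H.
apply (norm_RInt_le_const (V := R_NormedModule) (fun x => f x - g x - K) a b);
  [exact Hab|exact H|].
apply (is_RInt_minus (V := R_NormedModule) (fun x => f x - g x) (fun _ => K)).
- apply (is_RInt_minus (V := R_NormedModule)); now apply (RInt_correct (V := R_CompleteNormedModule)).
- apply (is_RInt_const (V := R_NormedModule)).
Qed.

(* Near a point where the derivative is [l], the difference of the integrands
   over opposite sides is a constant up to [eps] times the size, and the two
   constants [- k * Re l] and [h * Re l] cancel after integration. *)
Lemma boundary_int_local (f : C -> C) (x y : R) (eps : R) :
  cdifferentiable f (x, y) -> 0 < eps -> exists delta, 0 < delta /\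
    forall a c h k, a <= x <= a + h -> c <= y <= c + k -> h + k < delta ->
      cdiff_on_rect f a c h k ->
      Rabs (boundary_int f a c h k) <= 2 * eps * (h + k) ^ 2.
Proof.
intros [l Hl] Heps.
destruct (proj1 (cderiveP _ _ _) Hl eps Heps) as [d [Hd1 Hd2]].
exists d; split; [exact Hd1|].
intros a c h k Hx Hy Hhk H.
assert (B : forall s t, a <= s <= a + h -> c <= t <= c + k ->
  Cmod (f (s, t) - f (x, y) - ((s, t) - (x, y)) * l) <= eps * (h + k)).
{ intros s t Hs Ht.
  assert (Hm : Cmod ((s, t) - (x, y)) <= h + k).
  { eapply Rle_trans; [apply Cmod_le_Rabs|].
    unfold Re, Im; simpl.
    apply Rplus_le_compat; apply Rabs_le; lra. }
  eapply Rle_trans; [apply Hd2; lra|]; nra. }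
assert (D : forall s t s' t', a <= s <= a + h -> c <= t <= c + k ->
  a <= s' <= a + h -> c <= t' <= c + k ->
  Cmod (f (s, t) - f (s', t') - ((s, t) - (s', t')) * l) <= 2 * eps * (h + k)).
{ intros s t s' t' Hs Ht Hs' Ht'.
  replace (f (s, t) - f (s', t') - ((s, t) - (s', t')) * l)%C with
    ((f (s, t) - f (x, y) - ((s, t) - (x, y)) * l) +
     - (f (s', t') - f (x, y) - ((s', t') - (x, y)) * l))%C by ring.
  eapply Rle_trans; [apply Cmod_triangle|]; rewrite Cmod_opp.
  assert (B1 := B s t Hs Ht); assert (B2 := B s' t' Hs' Ht'); lra. }
assert (HH : Rabs (hint f c a (a + h) - hint f (c + k) a (a + h)
                   - (a + h - a) * (- k * Re l)) <= (a + h - a) * (2 * eps * (h + k))).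
{ apply RInt_near_const; [lra|eapply ex_hint; eauto; lra..|].
  intros s Hs.
  eapply Rle_trans; [|apply (D s c s (c + k)); lra].
  eapply Rle_trans; [|apply im_le_Cmod].
  apply Req_le; f_equal; unfold Re, Im; simpl; ring. }
assert (HV : Rabs (vint f (a + h) c (c + k) - vint f a c (c + k)
                   - (c + k - c) * (h * Re l)) <= (c + k - c) * (2 * eps * (h + k))).
{ apply RInt_near_const; [lra|eapply ex_vint; eauto; lra..|].
  intros t Ht.
  eapply Rle_trans; [|apply (D (a + h) t a t); lra].
  eapply Rle_trans; [|apply re_le_Cmod].
  apply Req_le; f_equal; unfold Re, Im; simpl; ring. }
(* The constants cancel, and the errors add up to (h + k) times 2 eps (h + k). *)
unfold boundary_int; apply Rabs_le.
apply Rabs_le_between in HH, HV; nra.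
Qed.

(** Dependent choice along a repeated halving: lower left corners increase, upper right corners
    decrease, so the rectangles have a common point. *)
Lemma nested_squares (P : nat -> R -> R -> Prop) (a c h k : R) :
  0 <= h -> 0 <= k -> P O a c ->
  (forall n a c, P n a c -> exists a' c', P (S n) a' c' /\
     a <= a' /\ a' + h / 2 ^ S n <= a + h / 2 ^ n /\
     c <= c' /\ c' + k / 2 ^ S n <= c + k / 2 ^ n) ->
  exists x y, forall n, exists a' c', P n a' c' /\
     a <= a' <= x /\ x <= a' + h / 2 ^ n <= a + h /\
     c <= c' <= y /\ y <= c' + k / 2 ^ n <= c + k.
Proof.
intros Hh Hk H0 HS.
(* Being an implication, [good] has a witness for every pair, with the dummy [(0, 0)] where [P]
   fails; choice then yields a total successor function. *)
pose (good n p q := P n (fst p) (snd p) -> P (S n) (fst q) (snd q) /\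
   fst p <= fst q /\ fst q + h / 2 ^ S n <= fst p + h / 2 ^ n /\
   snd p <= snd q /\ snd q + k / 2 ^ S n <= snd p + k / 2 ^ n : Prop).
assert (Hex : forall n p, exists q : R * R, good n p q).
{ intros n [a0 c0].
  destruct (classic (P n a0 c0)) as [Hp|Hp].
  - destruct (HS n a0 c0 Hp) as [a' [c' H']]; now exists (a', c').
  - exists (0, 0); intros H; now elim Hp. }
pose (next n p := proj1_sig (constructive_indefinite_description _ (Hex n p))).
assert (Hnext : forall n p, good n p (next n p))
  by (intros; apply (proj2_sig (constructive_indefinite_description _ (Hex n p)))).
pose (u := fix u n := match n with O => (a, c) | S m => next m (u m) end).
assert (HP : forall n, P n (fst (u n)) (snd (u n))).
{ induction n as [|n IH]; [exact H0|]; exact (proj1 (Hnext n (u n) IH)). }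
assert (Hstep := fun n => proj2 (Hnext n (u n) (HP n))).
change (forall n, fst (u n) <= fst (u (S n)) /\
  fst (u (S n)) + h / 2 ^ S n <= fst (u n) + h / 2 ^ n /\
  snd (u n) <= snd (u (S n)) /\
  snd (u (S n)) + k / 2 ^ S n <= snd (u n) + k / 2 ^ n) in Hstep.
(* One coordinate at a time: every left end lies below every right end, so the supremum of the left
   ends lies in all the intervals. *)
assert (Lim : forall (v : nat -> R) w, 0 <= w ->
  (forall n, v n <= v (S n) /\ v (S n) + w / 2 ^ S n <= v n + w / 2 ^ n) ->
  exists x, forall n, v O <= v n <= x /\ x <= v n + w / 2 ^ n <= v O + w).
{ intros v w Hw Hv.
  assert (Hpos : forall n, 0 <= w / 2 ^ n).
  { intros n; apply Rdiv_le_0_compat; [exact Hw|apply pow_lt; lra]. }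
  assert (Hmon : forall n m, v n <= v (n + m)%nat /\
      v (n + m)%nat + w / 2 ^ (n + m) <= v n + w / 2 ^ n).
  { intros n; induction m as [|m IH]; [rewrite Nat.add_0_r; lra|].
    rewrite Nat.add_succ_r; specialize (Hv (n + m)%nat); lra. }
  assert (Hub : forall n m, v m <= v n + w / 2 ^ n).
  { intros n m; destruct (Nat.le_ge_cases n m) as [L|L].
    - destruct (Nat.le_exists_sub _ _ L) as [j [-> _]].
      rewrite Nat.add_comm.
      specialize (Hmon n j); specialize (Hpos (n + j)%nat); lra.
    - destruct (Nat.le_exists_sub _ _ L) as [j [-> _]].
      rewrite Nat.add_comm.
      specialize (Hmon m j); specialize (Hpos (m + j)%nat); lra. }
  destruct (completeness (fun r => exists n, r = v n)) as [x [Hx1 Hx2]].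
  - exists (v O + w / 2 ^ 0); intros r [n ->]; apply Hub.
  - now exists (v O), O.
  - exists x; intros n; specialize (Hmon O n); simpl in Hmon.
    repeat split; try lra.
    + apply Hx1; now exists n.
    + apply Hx2; intros r [m ->]; apply Hub. }
destruct (Lim (fun n => fst (u n)) h Hh) as [x Hx].
{ intros n; specialize (Hstep n); tauto. }
destruct (Lim (fun n => snd (u n)) k Hk) as [y Hy].
{ intros n; specialize (Hstep n); tauto. }
exists x, y; intros n; exists (fst (u n)), (snd (u n)).
specialize (Hx n); specialize (Hy n); simpl in Hx, Hy.
repeat split; try apply HP; lra.
Qed.

(** At each bisection some quarter keeps at least a quarter of the absolute boundary integral.
    Around the limit point this lower bound, of order 4^-n, contradicts the local estimate with a
    small enough [eps]. *)
Theorem goursat (f : C -> C) (a c h k : R) :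
  0 < h -> 0 < k -> cdiff_on_rect f a c h k -> boundary_int f a c h k = 0.
Proof.
intros Hh Hk H.
destruct (Req_dec (boundary_int f a c h k) 0) as [E|E]; [exact E|exfalso].
apply Rabs_pos_lt in E.
set (J0 := Rabs (boundary_int f a c h k)) in E.
(* With this choice [J0 / 4 ^ n] equals 4 eps ((h + k)/2^n)^2, twice the upper bound of
   [boundary_int_local]. *)
set (eps := J0 / (4 * (h + k) ^ 2)).
assert (Hhk : 0 < (h + k) ^ 2) by (apply pow_lt; lra).
assert (Heps : 0 < eps) by (apply Rdiv_lt_0_compat; lra).
assert (Hp : forall n, 0 < 2 ^ n) by (intros; apply pow_lt; lra).
pose (P n a' c' := a <= a' /\ a' + h / 2 ^ n <= a + h /\ c <= c' /\ c' + k / 2 ^ n <= c + k /\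
   J0 / 4 ^ n <= Rabs (boundary_int f a' c' (h / 2 ^ n) (k / 2 ^ n))).
assert (Hsub : forall n a' c', P n a' c' -> cdiff_on_rect f a' c' (h / 2 ^ n) (k / 2 ^ n)).
{ intros n a' c' HP x y Hx Hy; unfold P in HP; apply H; lra. }
destruct (nested_squares P a c h k) as [x [y Hxy]]; try lra.
- unfold P; simpl; rewrite !Rdiv_1_r; unfold J0; lra.
- intros n a' c' HP.
  assert (Hpn := Hp n).
  assert (hn : 0 < h / 2 ^ n) by now apply Rdiv_lt_0_compat.
  assert (kn : 0 < k / 2 ^ n) by now apply Rdiv_lt_0_compat.
  assert (Eh : h / 2 ^ S n = h / 2 ^ n / 2) by (simpl; field; lra).
  assert (Ek : k / 2 ^ S n = k / 2 ^ n / 2) by (simpl; field; lra).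
  assert (EJ : J0 / 4 ^ S n = J0 / 4 ^ n / 4) by (simpl; field; apply pow_nonzero; lra).
  assert (Hs := boundary_int_split f a' c' (h / 2 ^ n) (k / 2 ^ n)
                  (Rlt_le _ _ hn) (Rlt_le _ _ kn) (Hsub _ _ _ HP)).
  unfold P in HP |- *; rewrite Eh, Ek, EJ.
  destruct HP as [P1 [P2 [P3 [P4 P5]]]].
  rewrite Hs in P5.
  (* If the first three quarters are all too small, the triangle inequality forces the fourth to be
     large. *)
  match type of P5 with _ <= Rabs (?A + ?B + ?C0 + ?D) =>
    assert (T1 := Rabs_triang (A + B + C0) D);
    assert (T2 := Rabs_triang (A + B) C0); assert (T3 := Rabs_triang A B);
    destruct (Rle_dec (J0 / 4 ^ n / 4) (Rabs A));
      [|destruct (Rle_dec (J0 / 4 ^ n / 4) (Rabs B));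
        [|destruct (Rle_dec (J0 / 4 ^ n / 4) (Rabs C0))]] end;
  [exists a', c'|exists (a' + h / 2 ^ n / 2), c'|exists a', (c' + k / 2 ^ n / 2)
  |exists (a' + h / 2 ^ n / 2), (c' + k / 2 ^ n / 2)]; repeat split; lra.
- destruct (boundary_int_local f x y eps) as [d [Hd1 Hd2]]; [|exact Heps|].
  { destruct (Hxy O) as [a' [c' Hac]]; apply H; simpl in Hac; lra. }
  destruct (pow_lt_1_zero (/ 2)) with (y := d / (h + k)) as [n Hn].
  { rewrite Rabs_pos_eq; lra. }
  { apply Rdiv_lt_0_compat; lra. }
  specialize (Hn n (le_n n)).
  assert (Hpn := Hp n).
  rewrite Rabs_pos_eq in Hn by (apply pow_le; lra).
  apply Rlt_div_r in Hn; [|lra].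
  destruct (Hxy n) as [a' [c' [HP Hac]]].
  specialize (Hd2 a' c' (h / 2 ^ n) (k / 2 ^ n)).
  assert (EQ : h / 2 ^ n + k / 2 ^ n = (/ 2) ^ n * (h + k))
    by (rewrite pow_inv; field; lra).
  rewrite EQ in Hd2.
  specialize (Hd2 ltac:(lra) ltac:(lra) ltac:(lra) (Hsub _ _ _ HP)).
  unfold P in HP; destruct HP as [_ [_ [_ [_ HJ]]]].
  assert (E4 : J0 / 4 ^ n = 4 * eps * ((/ 2) ^ n * (h + k)) ^ 2).
  { unfold eps; rewrite Rpow_mult_distr, <- pow_mult, Nat.mul_comm, pow_mult.
    replace ((/ 2) ^ 2) with (/ 4) by field.
    rewrite pow_inv; field; split; [apply pow_nonzero; lra|lra]. }
  assert (0 < (/ 2) ^ n) by (apply pow_lt; lra).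
  assert (0 < ((/ 2) ^ n * (h + k)) ^ 2) by (apply pow_lt; nra).
  nra.
Qed.

(** * Mean value property *)

Definition cexp (z : C) : C := (exp (Re z) * cos (Im z), exp (Re z) * sin (Im z)).

Lemma cexp_plus (z w : C) : cexp (z + w) = (cexp z * cexp w)%C.
Proof.
unfold cexp, Re, Im; apply injective_projections; simpl;
  rewrite exp_plus, ?cos_plus, ?sin_plus; ring.
Qed.

Lemma Cmod_cexp (z : C) : Cmod (cexp z) = exp (Re z).
Proof.
unfold Cmod, cexp; simpl.
assert (H := sin2_cos2 (Im z)); unfold Rsqr in H.
match goal with |- sqrt ?X = _ =>
  replace X with (Rsqr (exp (Re z)))
    by (unfold Rsqr; transitivity (exp (Re z) * exp (Re z) *
        (sin (Im z) * sin (Im z) + cos (Im z) * cos (Im z))); [rewrite H|]; ring) end.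
apply sqrt_Rsqr, Rlt_le, exp_pos.
Qed.

Lemma is_derive_eps_elim (f : R -> R) (l : R) : is_derive f 0 l ->
  forall eps, 0 < eps -> exists delta, 0 < delta /\
    forall u, Rabs u < delta -> Rabs (f u - f 0 - u * l) <= eps * Rabs u.
Proof.
intros [_ H] eps Heps.
destruct (H 0 (fun P HP => HP) (mkposreal eps Heps)) as [d Hd].
exists d; split; [apply cond_pos|].
intros u Hu; specialize (Hd u).
replace (f u - f 0 - u * l) with (f u - f 0 - (u - 0) * l) by ring.
rewrite <- (Rminus_0_r u) in Hu.
rewrite <- (Rminus_0_r u) at 3.
exact (Hd Hu).
Qed.

(** By [cexp_plus] only the expansion at 0 matters, and it follows from the real expansions of
    [exp], [cos] and [sin] there. *)
Lemma cderive_cexp (z : C) : cderive cexp z (cexp z).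
Proof.
assert (L : forall eps, 0 < eps -> exists delta, 0 < delta /\
  forall h, Cmod h < delta -> Cmod (cexp h - 1 - h) <= eps * Cmod h).
{ intros eps0 Heps0.
  (* The error terms [W1] to [W4] below contribute 1 + 2 + 3 + 2 = 8 multiples of [eps]. The cap 1
     bounds [exp a] and [1 + a], and the radius below [eps] makes the product in [W4] of second
     order. *)
  set (eps := Rmin 1 (eps0 / 8)).
  assert (Heps : 0 < eps) by (apply Rmin_pos; lra).
  assert (He1 : eps <= 1) by apply Rmin_l.
  assert (He8 : eps <= eps0 / 8) by apply Rmin_r.
  destruct (is_derive_eps_elim exp 1) with (eps := eps) as [d1 [Hd1 E1]]; auto.
  { auto_derive; [easy|rewrite exp_0; ring]. }
  destruct (is_derive_eps_elim cos 0) with (eps := eps) as [d2 [Hd2 E2]]; auto.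
  { auto_derive; [easy|rewrite sin_0; ring]. }
  destruct (is_derive_eps_elim sin 1) with (eps := eps) as [d3 [Hd3 E3]]; auto.
  { auto_derive; [easy|rewrite cos_0; ring]. }
  exists (Rmin eps (Rmin d1 (Rmin d2 d3))); split; [now repeat (apply Rmin_pos; [assumption|])|].
  intros [a b] Hh.
  assert (Ha : Rabs a <= Cmod (a, b)) by apply (re_le_Cmod (a, b)).
  assert (Hb : Rabs b <= Cmod (a, b)) by apply (im_le_Cmod (a, b)).
  assert (M1 := Rmin_l eps (Rmin d1 (Rmin d2 d3))).
  assert (M2 := Rmin_r eps (Rmin d1 (Rmin d2 d3))).
  assert (M3 := Rmin_l d1 (Rmin d2 d3)).
  assert (M4 := Rmin_r d1 (Rmin d2 d3)).
  assert (M5 := Rmin_l d2 d3). assert (M6 := Rmin_r d2 d3).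
  specialize (E1 a ltac:(lra)); specialize (E2 b ltac:(lra)); specialize (E3 b ltac:(lra)).
  rewrite exp_0, Rmult_1_r in E1. rewrite cos_0, Rmult_0_r, Rminus_0_r in E2.
  rewrite sin_0, Rmult_1_r, Rminus_0_r in E3.
  assert (Pa := Rabs_pos a); assert (Pb := Rabs_pos b).
  assert (X1 : Rabs (exp a - 1) <= 2 * Rabs a).
  { replace (exp a - 1) with ((exp a - 1 - a) + a) by ring.
    eapply Rle_trans; [apply Rabs_triang|]; nra. }
  assert (X2 : Rabs (exp a) <= 3).
  { replace (exp a) with ((exp a - 1) + 1) by ring.
    eapply Rle_trans; [apply Rabs_triang|]; rewrite Rabs_R1; lra. }
  assert (X3 : Rabs (1 + a) <= 2).
  { eapply Rle_trans; [apply Rabs_triang|]; rewrite Rabs_R1; lra. }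
  assert (X4 : Rabs (cos b) <= 1) by (apply Rabs_le, COS_bound).
  eapply Rle_trans; [apply Cmod_le_Rabs|].
  unfold cexp, Re, Im; simpl.
  replace (exp a * cos b + - (1) + - a)
    with ((exp a - 1 - a) * cos b + (1 + a) * (cos b - 1)) by ring.
  replace (exp a * sin b + - 0 + - b)
    with (exp a * (sin b - b) + (exp a - 1) * b) by ring.
  assert (Y1 := Rabs_triang ((exp a - 1 - a) * cos b) ((1 + a) * (cos b - 1))).
  assert (Y2 := Rabs_triang (exp a * (sin b - b)) ((exp a - 1) * b)).
  rewrite !Rabs_mult in Y1, Y2.
  assert (Z1 := Rabs_pos (exp a - 1 - a)); assert (Z2 := Rabs_pos (cos b - 1)).
  assert (Z3 := Rabs_pos (sin b - b)); assert (Z4 := Rabs_pos (exp a - 1)).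
  assert (W1 : Rabs (exp a - 1 - a) * Rabs (cos b) <= eps * Cmod (a, b)) by nra.
  assert (W2 : Rabs (1 + a) * Rabs (cos b - 1) <= 2 * (eps * Cmod (a, b))) by nra.
  assert (W3 : Rabs (exp a) * Rabs (sin b - b) <= 3 * (eps * Cmod (a, b))) by nra.
  assert (W4 : Rabs (exp a - 1) * Rabs b <= 2 * (eps * Cmod (a, b))) by nra.
  assert (eps * Cmod (a, b) <= eps0 / 8 * Cmod (a, b)).
  { apply Rmult_le_compat_r; [apply Cmod_ge_0|lra]. }
  lra. }
apply cderiveP; intros eps Heps.
assert (Hc : 0 < Cmod (cexp z)) by (rewrite Cmod_cexp; apply exp_pos).
destruct (L (eps / Cmod (cexp z))) as [d [Hd1 Hd2]]; [now apply Rdiv_lt_0_compat|].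
exists d; split; [exact Hd1|]; intros w Hw.
replace (cexp w) with (cexp z * cexp (w - z))%C
  by (rewrite <- cexp_plus; f_equal; ring).
replace (cexp z * cexp (w - z) - cexp z - (w - z) * cexp z)%C
  with (cexp z * (cexp (w - z) - 1 - (w - z)))%C by ring.
rewrite Cmod_mult.
eapply Rle_trans; [apply Rmult_le_compat_l, Hd2; [lra|exact Hw]|].
apply Req_le; field; lra.
Qed.

(* In logarithmic coordinates the punctured disc becomes a half-strip on which
   the function is periodic, so by Goursat's theorem its mean over a circle does
   not depend on the radius, and it tends to [L] as the radius shrinks. *)
Lemma re_center_nonneg (Q : C -> C) (rho : R) (L : C) :
  0 < rho ->
  (forall z, 0 < Cmod z <= rho -> cdifferentiable Q z) ->
  (forall z, Cmod z = rho -> 0 <= Re (Q z)) ->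
  (forall eps, 0 < eps -> exists delta, 0 < delta /\
    forall z, 0 < Cmod z < delta -> Cmod (Q z - L) <= eps) ->
  0 <= Re L.
Proof.
intros Hrho HQ Hpos Hlim.
apply Rnot_lt_le; intros Hneg.
(* This tolerance keeps Re Q at most [Re L / 2], which is negative, on small circles. *)
destruct (Hlim (- Re L / 2)) as [d [Hd1 Hd2]]; [lra|].
set (F := fun z => Q (cexp z)).
(* The vertical lines at [b] and [a] are mapped to the circle of radius [rho] and to a smaller one
   inside the disc of radius [d]. *)
set (b := ln rho); set (a := Rmin b (ln d) - 1).
assert (Hab : a < b) by (unfold a; assert (H := Rmin_l b (ln d)); lra).
assert (Had : exp a < d).
{ rewrite <- (exp_ln d) by exact Hd1; apply exp_increasing.
  unfold a; assert (H := Rmin_r b (ln d)); lra. }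
assert (HPI := PI_RGT_0).
assert (HF : cdiff_on_rect F a 0 (b - a) (2 * PI)).
{ intros x y Hx _; apply (cdiff_comp Q cexp).
  - apply HQ; rewrite Cmod_cexp; split; [apply exp_pos|].
    rewrite <- (exp_ln rho) by exact Hrho; unfold Re; simpl.
    destruct (Rle_lt_or_eq_dec x b) as [Hlt|Heq]; [lra| |].
    + now apply Rlt_le, exp_increasing.
    + rewrite Heq; apply Rle_refl.
  - eexists; apply cderive_cexp. }
assert (HG := goursat F a 0 (b - a) (2 * PI) ltac:(lra) ltac:(lra) HF).
unfold boundary_int in HG; replace (a + (b - a)) with b in HG by ring.
(* By periodicity the horizontal sides cancel, so the two vertical integrals agree; but one is
   nonnegative and the other negative. *)
assert (Hper : hint F (0 + 2 * PI) a b = hint F 0 a b).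
{ apply RInt_ext; intros x _; unfold F, cexp, Re, Im; simpl.
  now rewrite Rplus_0_l, cos_2PI, sin_2PI, cos_0, sin_0. }
assert (Hb : 0 <= vint F b 0 (0 + 2 * PI)).
{ apply RInt_ge_0; [lra|eapply ex_vint; eauto; lra|].
  intros t _; apply Hpos; rewrite Cmod_cexp; now apply exp_ln. }
assert (Ha : vint F a 0 (0 + 2 * PI) <= (0 + 2 * PI - 0) * (Re L / 2)).
{ eapply Rle_trans; [|apply Req_le, (RInt_const (V := R_CompleteNormedModule))].
  apply RInt_le; [lra|eapply ex_vint; eauto; lra|apply ex_RInt_const|].
  intros t _.
  assert (H : Rabs (Re (F (a, t) - L)%C) <= - Re L / 2).
  { eapply Rle_trans; [apply re_le_Cmod|].
    apply Hd2; rewrite Cmod_cexp; split; [apply exp_pos|exact Had]. }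
  rewrite re_minus in H; apply Rabs_le_between in H; lra. }
nra.
Qed.

Lemma cdiff_continuous (f : C -> C) (z : C) : cdifferentiable f z ->
  forall eps, 0 < eps -> exists delta, 0 < delta /\
    forall w, Cmod (w - z) < delta -> Cmod (f w - f z) <= eps.
Proof.
intros [l Hl] eps Heps.
destruct (proj1 (cderiveP _ _ _) Hl 1 Rlt_0_1) as [d [Hd1 Hd2]].
assert (Hl0 := Cmod_ge_0 l).
exists (Rmin d (eps / (1 + Cmod l))); split.
{ apply Rmin_pos; [lra|apply Rdiv_lt_0_compat; lra]. }
intros w Hw.
assert (H1 := Rlt_le_trans _ _ _ Hw (Rmin_l _ _)).
assert (H2 := Rlt_le_trans _ _ _ Hw (Rmin_r _ _)).
apply Rlt_div_r in H2; [|lra].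
replace (f w - f z)%C with ((f w - f z - (w - z) * l) + (w - z) * l)%C by ring.
eapply Rle_trans; [apply Cmod_triangle|].
rewrite Cmod_mult; specialize (Hd2 w H1); lra.
Qed.

(* On the circle of radius [rho] the kernel [2 + c z / rho + c^* rho / z] is real
   and nonnegative. The last summand of [Q] has there the same real part as
   [G 0 c^* rho / z], the pole subtracted in the second one. *)
Lemma disc_derivative_bound_scaled (G : C -> C) (l c : C) (rho : R) :
  (forall z, Cmod z < 1 -> cdifferentiable G z) ->
  (forall z, Cmod z < 1 -> 0 <= Re (G z)) ->
  cderive G 0 l -> 0 < rho < 1 -> Cmod c = 1 ->
  0 <= Re (2 * G 0 + Cconj c * rho * l)%C.
Proof.
intros HG Hpos Hl Hrho Hc.
assert (Hr0 : RtoC rho <> 0) by (intros H; apply RtoC_inj in H; lra).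
set (A := fun z => (G z * (2 + c / rho * z) + Cconj (G 0) * (c / rho) * z)%C).
apply (re_center_nonneg
  (fun z => (A z + Cconj c * rho * ((G z - G 0) * / z))%C) rho).
- lra.
- intros z Hz.
  assert (z <> 0) by (apply Cmod_gt_0; lra).
  assert (cdifferentiable G z) by (apply HG; lra).
  unfold A; cdiff.
- intros z Hz.
  assert (Hz0 : z <> 0) by (apply Cmod_gt_0; lra).
  set (p := (c / rho * z)%C).
  assert (Hp : Cmod p = 1).
  { unfold p; rewrite Cmod_mult, Cmod_div, Hc, Hz, Cmod_R, Rabs_pos_eq by (auto; lra).
    field; lra. }
  (* On the circle, z times its conjugate is rho^2, which turns 1/z into a conjugate. *)
  assert (Hinv : (Cconj c * rho * / z = Cconj p)%C).
  { unfold p; rewrite Cmult_conj, Cdiv_conj by exact Hr0.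
    assert (E : (RtoC rho * RtoC rho = z * Cconj z)%C).
    { rewrite <- Cmod2_conj, Hz, <- RtoC_mult; f_equal; ring. }
    assert (Er : Cconj rho = rho)
      by (apply injective_projections; simpl; ring).
    rewrite Er.
    transitivity (Cconj c * (RtoC rho * RtoC rho) / (rho * z))%C; [field; auto|].
    rewrite E; field; auto. }
  replace (A z + Cconj c * rho * ((G z - G 0) * / z))%C
    with (G z * (2 + p) + Cconj (G 0) * p + Cconj p * (G z - G 0))%C
    by (rewrite <- Hinv; unfold A, p; ring).
  assert (Hre : -1 <= Re p).
  { assert (H := re_le_Cmod p); rewrite Hp in H; apply Rabs_le_between in H; lra. }
  specialize (Hpos z ltac:(lra)).
  (* The terms with [G 0] are conjugates of each other with opposite signs, so their real parts
     cancel; p plus its conjugate is 2 Re p. *)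
  replace (Re (G z * (2 + p) + Cconj (G 0) * p + Cconj p * (G z - G 0))%C)
    with (2 * (Re (G z) * (1 + Re p))) by (unfold Re; simpl; ring).
  nra.
- intros eps Heps.
  assert (DA : cdifferentiable A 0).
  { assert (cdifferentiable G 0) by (now exists l).
    unfold A; cdiff. }
  destruct (cdiff_continuous A 0 DA (eps / 2)) as [d1 [Hd1 E1]]; [lra|].
  destruct (proj1 (cderiveP _ _ _) Hl (eps / 2)) as [d2 [Hd2 E2]]; [lra|].
  exists (Rmin d1 d2); split; [now apply Rmin_pos|].
  intros z [Hz Hzd].
  assert (H1 := Rlt_le_trans _ _ _ Hzd (Rmin_l _ _)).
  assert (H2 := Rlt_le_trans _ _ _ Hzd (Rmin_r _ _)).
  assert (Hz0 : z <> 0) by (now apply Cmod_gt_0).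
  assert (Z0 : (z - 0 = z)%C) by ring.
  specialize (E1 z); specialize (E2 z); rewrite !Z0 in E1, E2.
  specialize (E1 H1); specialize (E2 H2).
  replace (A z + Cconj c * rho * ((G z - G 0) * / z) - (2 * G 0 + Cconj c * rho * l))%C
    with ((A z - A 0) + (Cconj c * rho / z) * (G z - G 0 - z * l))%C
    by (unfold A; field; auto).
  eapply Rle_trans; [apply Cmod_triangle|].
  rewrite Cmod_mult, Cmod_div, Cmod_mult, Cmod_conj, Hc, Cmod_R, Rabs_pos_eq
    by (auto; lra).
  assert (1 * rho / Cmod z * Cmod (G z - G 0 - z * l) <= eps / 2); [|lra].
  apply Rle_trans with (1 * rho / Cmod z * (eps / 2 * Cmod z)).
  { apply Rmult_le_compat_l; [|exact E2]; apply Rdiv_le_0_compat; lra. }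
  replace (1 * rho / Cmod z * (eps / 2 * Cmod z)) with (rho * (eps / 2)) by (field; lra).
  nra.
Qed.

(** Taking c = -l/|l| in the scaled bound makes the derivative term -rho |l|; then rho tends to
    1. *)
Lemma disc_derivative_bound (G : C -> C) (l : C) :
  (forall z, Cmod z < 1 -> cdifferentiable G z) ->
  (forall z, Cmod z < 1 -> 0 <= Re (G z)) ->
  cderive G 0 l -> Cmod l <= 2 * Re (G 0).
Proof.
intros HG Hpos Hl.
assert (H0 : 0 <= Re (G 0)) by (apply Hpos; rewrite Cmod_0; lra).
destruct (Req_dec (Cmod l) 0) as [E|E]; [lra|].
assert (Hm : 0 < Cmod l) by (assert (H := Cmod_ge_0 l); lra).
assert (HlC : RtoC (Cmod l) <> 0) by (intros H; apply RtoC_inj in H; lra).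
assert (H : forall rho, 0 < rho < 1 -> rho * Cmod l <= 2 * Re (G 0)).
{ intros rho Hrho.
  assert (H := disc_derivative_bound_scaled G l (- l / Cmod l)%C rho HG Hpos Hl Hrho).
  assert (E1 : (Cconj (- l / Cmod l) * rho * l = - RtoC (rho * Cmod l))%C).
  { rewrite Cdiv_conj, Copp_conj by exact HlC.
    replace (Cconj (Cmod l)) with (RtoC (Cmod l))
      by (apply injective_projections; simpl; ring).
    transitivity (- (rho * (l * Cconj l)) / Cmod l)%C; [field; auto|].
    rewrite <- Cmod2_conj; simpl.
    rewrite Rmult_1_r, !RtoC_mult; field; auto. }
  rewrite E1 in H.
  replace (Re (2 * G 0 + - RtoC (rho * Cmod l))%C)
    with (2 * Re (G 0) - rho * Cmod l) in H by (unfold Re; simpl; ring).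
  enough (0 <= 2 * Re (G 0) - rho * Cmod l) by lra.
  apply H; rewrite Cmod_div, Cmod_opp, Cmod_R, Rabs_pos_eq by (auto; lra); field; lra. }
apply Rnot_lt_le; intros Hlt.
assert (Hq : 2 * Re (G 0) / Cmod l < 1) by (apply Rlt_div_l; lra).
assert (Hq0 : 0 <= 2 * Re (G 0) / Cmod l) by (apply Rdiv_le_0_compat; lra).
(* This radius is the midpoint of 2 Re G(0)/|l| and 1, where the bound already fails. *)
specialize (H ((1 + 2 * Re (G 0) / Cmod l) / 2) ltac:(lra)).
replace ((1 + 2 * Re (G 0) / Cmod l) / 2 * Cmod l)
  with ((Cmod l + 2 * Re (G 0)) / 2) in H by (field; lra).
lra.
Qed.

(** * Schwarz-Pick lemma and Harnack inequality *)

(** The Cayley transform, scaled and shifted so that 0 goes to x + iy. *)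
Definition disc_to_half_plane (x y : R) (w : C) : C :=
  (RtoC x * ((1 + w) * / (1 - w)) + (0, y))%C.

Lemma disc_neq_1 (w : C) : Cmod w < 1 -> (1 - w)%C <> 0.
Proof.
intros Hw H.
assert (E : w = RtoC 1) by (replace w with (1 - (1 - w))%C by ring; rewrite H; ring).
rewrite E, Cmod_1 in Hw; lra.
Qed.

Lemma cderive_disc_to_half_plane (x y : R) (w : C) : Cmod w < 1 ->
  cderive (disc_to_half_plane x y) w (2 * x / ((1 - w) * (1 - w))).
Proof.
intros Hw; apply disc_neq_1 in Hw.
assert (H1 : cderive (fun w => 1 - w)%C w (0 - 1))
  by (apply (cderive_minus (fun _ => RtoC 1) (fun w => w));
      [apply cderive_const|apply cderive_id]).
assert (H2 := cderive_comp Cinv (fun w => 1 - w)%C w _ _ (cderive_inv _ Hw) H1).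
assert (H3 : cderive (fun w => 1 + w)%C w (0 + 1))
  by (apply (cderive_plus (fun _ => RtoC 1) (fun w => w));
      [apply cderive_const|apply cderive_id]).
assert (H4 := cderive_mult _ _ w _ _ H3 H2).
assert (H5 := cderive_mult _ _ w _ _ (cderive_const x w) H4).
assert (H6 := cderive_plus _ _ w _ _ H5 (cderive_const (0, y) w)).
cbv beta in H6.
match type of H6 with cderive _ _ ?l =>
  replace (2 * x / ((1 - w) * (1 - w)))%C with l by (field; exact Hw) end.
exact H6.
Qed.

Lemma re_disc_to_half_plane (x y : R) (w : C) : Cmod w < 1 ->
  Re (disc_to_half_plane x y w) = x * (1 - Cmod w ^ 2) / Cmod (1 - w) ^ 2.
Proof.
intros Hw; apply disc_neq_1 in Hw; apply Cmod_gt_0 in Hw.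
assert (H : 0 < Cmod (1 - w) ^ 2) by now apply pow_lt.
rewrite !Cmod2_alt in *.
destruct w as [u v]; unfold disc_to_half_plane, Re, Im in *; simpl in *.
field; nra.
Qed.

Definition positive_real_part (g : C -> C) : Prop :=
  forall z, 0 < Re z -> cdifferentiable g z /\ 0 <= Re (g z).

Lemma re_disc_to_half_plane_pos (x y : R) (w : C) : 0 < x -> Cmod w < 1 ->
  0 < Re (disc_to_half_plane x y w).
Proof.
intros Hx Hw; rewrite re_disc_to_half_plane by exact Hw.
assert (H0 := Cmod_ge_0 w).
apply Rdiv_lt_0_compat; [apply Rmult_lt_0_compat; nra|].
apply pow_lt, Cmod_gt_0, disc_neq_1, Hw.
Qed.

(** The disc bound is applied to [g] after the Cayley transform centred at [z], whose derivative at
    0 is 2 Re z. *)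
Lemma schwarz_pick (g : C -> C) (z l : C) :
  positive_real_part g -> 0 < Re z -> cderive g z l ->
  Cmod l * Re z <= Re (g z).
Proof.
intros Hg Hz Hl.
assert (M0 : Cmod (RtoC 0) < 1) by (rewrite Cmod_0; lra).
assert (E0 : disc_to_half_plane (Re z) (Im z) 0 = z).
{ unfold disc_to_half_plane; apply injective_projections; simpl; unfold Re, Im; field. }
set (G := fun w => g (disc_to_half_plane (Re z) (Im z) w)).
assert (H : Cmod (2 * Re z / ((1 - 0) * (1 - 0)) * l) <= 2 * Re (G 0)).
{ apply disc_derivative_bound.
  - intros w Hw; apply (cdiff_comp g).
    + now apply Hg, re_disc_to_half_plane_pos.
    + eexists; now apply cderive_disc_to_half_plane.
  - intros w Hw; now apply Hg, re_disc_to_half_plane_pos.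
  - apply (cderive_comp g); [now rewrite E0|now apply cderive_disc_to_half_plane]. }
unfold G in H; rewrite E0 in H.
replace (2 * Re z / ((1 - 0) * (1 - 0)) * l)%C with (RtoC (2 * Re z) * l)%C in H
  by (rewrite RtoC_mult; field).
rewrite Cmod_mult, Cmod_R, Rabs_pos_eq in H by lra; lra.
Qed.

(** Here [m] serves as an integrating factor, turning a differential inequality for [N] into a
    comparison of end values. *)
Lemma weighted_nondecreasing (N m dN dm : R -> R) :
  (forall t, 0 <= t <= 1 -> is_derive N t (dN t)) ->
  (forall t, 0 <= t <= 1 -> is_derive m t (dm t)) ->
  (forall t, 0 <= t <= 1 -> 0 <= dN t * m t + N t * dm t) ->
  N 0 * m 0 <= N 1 * m 1.
Proof.
intros HN Hm Hpos.
assert (HP : forall t, 0 <= t <= 1 ->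
  is_derive (fun t => N t * m t) t (dN t * m t + N t * dm t)).
{ intros t Ht; apply (is_derive_mult N m); [now apply HN|now apply Hm|apply Rmult_comm]. }
destruct (MVT_gen (fun t => N t * m t) 0 1 (fun t => dN t * m t + N t * dm t))
  as [s [Hs E]]; rewrite ?Rmin_left, ?Rmax_right in * by lra.
- intros t Ht; apply HP; lra.
- intros t Ht; apply continuity_pt_filterlim.
  apply (ex_derive_continuous (V := R_NormedModule) (fun t => N t * m t)).
  eexists; exact (HP t Ht).
- specialize (Hpos s Hs); lra.
Qed.

(* Along the radius ending at [w] the squared modulus has logarithmic derivative
   at most [4 a / (1 - (a t)^2)] in absolute value, where [a = Cmod w]; the weights
   are the functions with exactly this logarithmic derivative, up to sign. *)
Lemma radial_growth (G : C -> C) (w : C) :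
  Cmod w < 1 ->
  (forall z, Cmod z < 1 ->
    exists l, cderive G z l /\ Cmod l * (1 - Cmod z ^ 2) <= 2 * Cmod (G z)) ->
  Cmod (G w) * (1 - Cmod w) <= Cmod (G 0) * (1 + Cmod w) /\
  Cmod (G 0) * (1 - Cmod w) <= Cmod (G w) * (1 + Cmod w).
Proof.
intros Hw HG.
set (a := Cmod w) in *.
assert (Ha : 0 <= a) by apply Cmod_ge_0.
(* The square stays differentiable at zeros of [G], where the modulus itself may fail to be. *)
pose (N t := Cmod (G (0 + RtoC t * w)%C) ^ 2).
assert (HN : forall t, exists dN, 0 <= t <= 1 ->
  is_derive N t dN /\ Rabs dN <= 4 * a / (1 - (a * t) ^ 2) * N t).
{ intros t; destruct (classic (0 <= t <= 1)) as [Ht|Ht]; [|now exists 0].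
  set (z := (0 + RtoC t * w)%C).
  assert (Hz : Cmod z = a * t).
  { unfold z; rewrite Cplus_0_l, Cmod_mult, Cmod_R, Rabs_pos_eq by lra; apply Rmult_comm. }
  assert (Hat : 0 <= a * t < 1) by nra.
  destruct (HG z) as [l [Hl Hb]]; [lra|].
  destruct (cderive_line G 0 w l t Hl) as [HR HI].
  exists (2 * Re (Cconj (G z) * (w * l))%C); intros _; split.
  - apply (is_derive_ext (fun u => Re (G (0 + RtoC u * w)%C) ^ 2
                                   + Im (G (0 + RtoC u * w)%C) ^ 2)).
    { intros u; unfold N; now rewrite Cmod2_alt. }
    replace (2 * Re (Cconj (G z) * (w * l))%C)
      with (2 * Re (w * l)%C * Re (G z) ^ 1 + 2 * Im (w * l)%C * Im (G z) ^ 1)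
      by (unfold Re, Im; simpl; ring).
    apply (is_derive_plus (V := R_NormedModule)).
    + exact (is_derive_pow _ 2 t _ HR).
    + exact (is_derive_pow _ 2 t _ HI).
  - rewrite Rabs_mult, (Rabs_pos_eq 2) by lra.
    assert (H := re_le_Cmod (Cconj (G z) * (w * l))%C).
    rewrite !Cmod_mult, Cmod_conj in H; fold a in H.
    rewrite Hz in Hb.
    assert (Hd : 0 < 1 - (a * t) ^ 2) by nra.
    apply Rle_div_r in Hb; [|lra].
    assert (HG0 := Cmod_ge_0 (G z)).
    eapply Rle_trans; [apply Rmult_le_compat_l, H; lra|].
    unfold N; fold z.
    replace (4 * a / (1 - (a * t) ^ 2) * Cmod (G z) ^ 2)
      with (2 * (Cmod (G z) * (a * (2 * Cmod (G z) / (1 - (a * t) ^ 2))))) by (field; lra).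
    repeat (apply Rmult_le_compat_l; [lra|]); exact Hb. }
pose (dN t := proj1_sig (constructive_indefinite_description _ (HN t))).
assert (HdN : forall t, 0 <= t <= 1 ->
  is_derive N t (dN t) /\ Rabs (dN t) <= 4 * a / (1 - (a * t) ^ 2) * N t)
  by (intros t; exact (proj2_sig (constructive_indefinite_description _ (HN t)))).
assert (Hat : forall t, 0 <= t <= 1 -> 0 <= a * t < 1) by (intros; nra).
(* The minus sign in the weight expresses a decreasing product through [weighted_nondecreasing]; [U]
   bounds [G w] from above and [L] from below. *)
assert (U : N 0 * - ((1 - a * 0) / (1 + a * 0)) ^ 2 <= N 1 * - ((1 - a * 1) / (1 + a * 1)) ^ 2).
{ apply (weighted_nondecreasing N (fun t => - ((1 - a * t) / (1 + a * t)) ^ 2) dN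
    (fun t => 4 * a / (1 - (a * t) ^ 2) * ((1 - a * t) / (1 + a * t)) ^ 2)).
  - apply HdN.
  - intros t Ht; specialize (Hat t Ht).
    auto_derive; [lra|field; nra].
  - intros t Ht; destruct (HdN t Ht) as [_ H]; apply Rabs_le_between in H.
    assert (0 <= ((1 - a * t) / (1 + a * t)) ^ 2) by apply pow2_ge_0.
    nra. }
assert (L : N 0 * ((1 + a * 0) / (1 - a * 0)) ^ 2 <= N 1 * ((1 + a * 1) / (1 - a * 1)) ^ 2).
{ apply (weighted_nondecreasing N (fun t => ((1 + a * t) / (1 - a * t)) ^ 2) dN
    (fun t => 4 * a / (1 - (a * t) ^ 2) * ((1 + a * t) / (1 - a * t)) ^ 2)).
  - apply HdN.
  - intros t Ht; specialize (Hat t Ht).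
    auto_derive; [lra|field; nra].
  - intros t Ht; destruct (HdN t Ht) as [_ H]; apply Rabs_le_between in H.
    assert (0 <= ((1 + a * t) / (1 - a * t)) ^ 2) by apply pow2_ge_0.
    nra. }
assert (E0 : N 0 = Cmod (G 0) ^ 2) by (unfold N; do 3 f_equal; ring).
assert (E1 : N 1 = Cmod (G w) ^ 2) by (unfold N; do 3 f_equal; ring).
rewrite E0, E1 in *.
assert (P0 := Cmod_ge_0 (G 0)); assert (P1 := Cmod_ge_0 (G w)).
assert (F : forall p q, 0 <= p -> 0 <= q -> p ^ 2 <= q ^ 2 -> p <= q)
  by (intros p q Hp Hq H; apply Rsqr_incr_0_var; [unfold Rsqr; lra|exact Hq]).
split; apply F; try nra.
- apply (Rmult_le_reg_r (/ (1 + a) ^ 2)); [apply Rinv_0_lt_compat, pow_lt; lra|].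
  rewrite !Rpow_mult_distr, !Rmult_assoc, Rinv_r, Rmult_1_r by (apply pow_nonzero; lra).
  rewrite Rmult_0_r, Rmult_1_r, Rminus_0_r, Rplus_0_r, Rdiv_1_r in U.
  unfold Rdiv in U; rewrite Rpow_mult_distr, pow_inv in U; lra.
- apply (Rmult_le_reg_r (/ (1 - a) ^ 2)); [apply Rinv_0_lt_compat, pow_lt; lra|].
  rewrite !Rpow_mult_distr, !Rmult_assoc, Rinv_r, Rmult_1_r by (apply pow_nonzero; lra).
  rewrite Rmult_0_r, Rmult_1_r, Rminus_0_r, Rplus_0_r, Rdiv_1_r in L.
  unfold Rdiv in L; rewrite Rpow_mult_distr, pow_inv in L; lra.
Qed.

(** The Cayley transform centred at [r] sends w = (xi - r)/(xi + r) to [xi], so [radial_growth]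
    compares the values of [g] at [xi] and [r]. *)
Lemma harnack (g : C -> C) (r : R) (xi : C) :
  positive_real_part g -> 0 < r -> 0 < Re xi ->
  Cmod (g xi) * (r * Re xi) <= (r ^ 2 + Cmod xi ^ 2) * Cmod (g r) /\
  Cmod (g r) * (r * Re xi) <= (r ^ 2 + Cmod xi ^ 2) * Cmod (g xi).
Proof.
intros Hg Hr Hxi.
set (A := Cmod (xi + r)); set (B := Cmod (xi - r)).
assert (HA2 : A ^ 2 = (Re xi + r) ^ 2 + Im xi ^ 2)
  by (unfold A; rewrite Cmod2_alt; unfold Re, Im; simpl; ring).
assert (HB2 : B ^ 2 = (Re xi - r) ^ 2 + Im xi ^ 2)
  by (unfold B; rewrite Cmod2_alt; unfold Re, Im; simpl; ring).
assert (HX2 := Cmod2_alt xi).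
assert (HA0 : 0 <= A) by apply Cmod_ge_0.
assert (HB0 : 0 <= B) by apply Cmod_ge_0.
assert (HA : 0 < A) by nra.
assert (HBA : B < A) by nra.
assert (Hxr : (xi + r)%C <> 0) by (now apply Cmod_gt_0).
assert (Hr0 : RtoC r <> 0) by (intros H; apply RtoC_inj in H; lra).
set (w := ((xi - r) / (xi + r))%C).
assert (Hwm : Cmod w = B / A) by (now apply Cmod_div).
assert (Hw : Cmod w < 1) by (rewrite Hwm; apply Rlt_div_l; lra).
destruct (radial_growth (fun z => g (disc_to_half_plane r 0 z)) w Hw) as [H1 H2].
(* The derivative of the transform has modulus 2r/|1 - z|^2, and times 1 - |z|^2 this is twice the
   real part of the image; Schwarz-Pick then bounds the product by 2 Re g, hence by 2|g|. *)
{ intros z Hz.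
  assert (Hpos := re_disc_to_half_plane_pos r 0 z Hr Hz).
  destruct (Hg _ Hpos) as [[l Hl] _].
  eexists; split.
  - apply (cderive_comp g); [exact Hl|now apply cderive_disc_to_half_plane].
  - assert (H := schwarz_pick g _ l Hg Hpos Hl).
    assert (Hre := re_le_Cmod (g (disc_to_half_plane r 0 z))).
    apply Rabs_le_between in Hre.
    rewrite (re_disc_to_half_plane r 0 z Hz) in H.
    assert (Hz1 := disc_neq_1 z Hz).
    assert (Hz2 := proj1 (Cmod_gt_0 _) Hz1).
    rewrite Cmod_mult, Cmod_div, <- RtoC_mult, Cmod_R, Rabs_pos_eq, Cmod_mult
      by (try lra; now apply Cmult_neq_0).
    replace (2 * r / (Cmod (1 - z) * Cmod (1 - z)) * Cmod l * (1 - Cmod z ^ 2))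
      with (2 * (Cmod l * (r * (1 - Cmod z ^ 2) / Cmod (1 - z) ^ 2)))
      by (field; lra).
    lra. }
assert (Ew : disc_to_half_plane r 0 w = xi).
{ unfold disc_to_half_plane.
  transitivity (r * ((1 + w) * / (1 - w)))%C;
    [apply injective_projections; simpl; ring|].
  unfold w; field; split; [exact Hxr|].
  replace (xi + r - (xi - r))%C with (2 * r)%C by ring.
  apply Cmult_neq_0; [intros H; apply RtoC_inj in H; lra|exact Hr0]. }
assert (E0 : disc_to_half_plane r 0 0 = r)
  by (unfold disc_to_half_plane; apply injective_projections; simpl; field).
rewrite Ew, E0, Hwm in H1, H2.
(* Multiply by A (A + B) and use A^2 - B^2 = 4 r Re xi together with (A + B)^2 <= 2 (A^2 + B^2) = 4
   (r^2 + |xi|^2). *)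
assert (K : forall p q, 0 <= q -> p * (1 - B / A) <= q * (1 + B / A) ->
  p * (r * Re xi) <= (r ^ 2 + Cmod xi ^ 2) * q).
{ intros p q Hq H.
  assert (H' : p * (A - B) <= q * (A + B)).
  { apply (Rmult_le_reg_r (/ A)); [now apply Rinv_0_lt_compat|].
    replace (p * (A - B) * / A) with (p * (1 - B / A)) by (field; lra).
    replace (q * (A + B) * / A) with (q * (1 + B / A)) by (field; lra).
    exact H. }
  assert (H'' : p * (A - B) * (A + B) <= q * (A + B) * (A + B))
    by (apply Rmult_le_compat_r; lra).
  replace (p * (A - B) * (A + B)) with (p * (A ^ 2 - B ^ 2)) in H'' by ring.
  assert (Hsq : (A + B) ^ 2 <= 2 * (A ^ 2 + B ^ 2)) by nra.
  assert (H0 : q * (A + B) ^ 2 <= q * (2 * (A ^ 2 + B ^ 2)))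
    by (now apply Rmult_le_compat_l).
  assert (D1 : A ^ 2 - B ^ 2 = 4 * (r * Re xi)) by (rewrite HA2, HB2; ring).
  assert (D2 : A ^ 2 + B ^ 2 = 2 * (r ^ 2 + Cmod xi ^ 2)) by (rewrite HA2, HB2, HX2; ring).
  rewrite D1 in H''; rewrite D2 in H0; lra. }
split; apply K; auto using Cmod_ge_0.
Qed.

(** * Two-sided bounds for Rogers functions *)

Lemma Rogers_quotient (f : C -> C) :
  Rogers f -> positive_real_part (fun z => (f z / z)%C).
Proof.
intros [Hf Hre] z Hz; split; [|now apply Hre].
assert (Hz0 : z <> 0) by (intros ->; simpl in Hz; lra).
apply (cdiff_mult f Cinv); [apply ex_derive_cderive, Hf, Hz|now apply cdiff_inv].
Qed.

Theorem proposition6p6 (f : C -> C) (r : R) (xi : C)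
    (Hf : Rogers f) (Hr : 0 < r) (Hxi : 0 < Re xi) :
  1 / sqrt 2 * (Cmod xi ^ 2 / (r ^ 2 + Cmod xi ^ 2)) * (Re xi / Cmod xi)
      * Cmod (f (RtoC r)) <= Cmod (f xi) /\
  Cmod (f xi) <=
    sqrt 2 * ((r ^ 2 + Cmod xi ^ 2) / r ^ 2) * (Cmod xi / Re xi)
      * Cmod (f (RtoC r)).
Proof.
assert (Hxi0 : xi <> 0) by (intros ->; simpl in Hxi; lra).
assert (Hr0 : RtoC r <> 0) by (intros H; apply RtoC_inj in H; lra).
destruct (harnack _ r xi (Rogers_quotient f Hf) Hr Hxi) as [H1 H2].
rewrite !Cmod_div, Cmod_R, Rabs_pos_eq in H1, H2 by (auto; lra).
assert (Hm := proj1 (Cmod_gt_0 _) Hxi0).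
assert (Hs : 1 <= sqrt 2) by (rewrite <- sqrt_1 at 1; apply sqrt_le_1_alt; lra).
assert (Pr := Cmod_ge_0 (f r)); assert (Px := Cmod_ge_0 (f xi)).
set (X := Cmod xi) in *; set (x := Re xi) in *.
assert (HD : 0 < r ^ 2 + X ^ 2) by nra.
split.
(* The Harnack inequality gives the constant 1, which dominates 1/sqrt 2; the upper bound passes
   from 1 to sqrt 2 likewise. *)
- apply Rle_trans with (1 * (X * x / (r ^ 2 + X ^ 2) * Cmod (f r))).
  + replace (1 / sqrt 2 * (X ^ 2 / (r ^ 2 + X ^ 2)) * (x / X) * Cmod (f r))
      with (1 / sqrt 2 * (X * x / (r ^ 2 + X ^ 2) * Cmod (f r))) by (field; lra).
    apply Rmult_le_compat_r.
    * apply Rmult_le_pos; [apply Rdiv_le_0_compat; nra|exact Pr].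
    * apply Rle_div_l; lra.
  (* This factor turns the goal into [H2], whose terms are the moduli of f(z)/z at [r] and [xi]. *)
  + apply (Rmult_le_reg_r ((r ^ 2 + X ^ 2) / X)); [now apply Rdiv_lt_0_compat|].
    replace (1 * (X * x / (r ^ 2 + X ^ 2) * Cmod (f r)) * ((r ^ 2 + X ^ 2) / X))
      with (Cmod (f r) / r * (r * x)) by (field; lra).
    replace (Cmod (f xi) * ((r ^ 2 + X ^ 2) / X))
      with ((r ^ 2 + X ^ 2) * (Cmod (f xi) / X)) by (field; lra).
    exact H2.
- apply Rle_trans with (1 * ((r ^ 2 + X ^ 2) / r ^ 2 * (X / x) * Cmod (f r))).
  + apply (Rmult_le_reg_r (r * x / X)); [apply Rdiv_lt_0_compat; nra|].
    replace (Cmod (f xi) * (r * x / X)) with (Cmod (f xi) / X * (r * x)) by (field; lra).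
    replace (1 * ((r ^ 2 + X ^ 2) / r ^ 2 * (X / x) * Cmod (f r)) * (r * x / X))
      with ((r ^ 2 + X ^ 2) * (Cmod (f r) / r)) by (field; lra).
    exact H1.
  + replace (sqrt 2 * ((r ^ 2 + X ^ 2) / r ^ 2) * (X / x) * Cmod (f r))
      with (sqrt 2 * ((r ^ 2 + X ^ 2) / r ^ 2 * (X / x) * Cmod (f r))) by ring.
    apply Rmult_le_compat_r; [|exact Hs].
    apply Rmult_le_pos; [|exact Pr].
    apply Rmult_le_pos; apply Rdiv_le_0_compat; try lra; now apply pow_lt.
Qed.
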